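(* Let $D$ be a finite domain, $r$ a database instance over $D$, $IC$ a set of binary integrity constraints, and let $\Pi(r)$ be the repair program of $r$ with respect to $IC$, i.e. the change program $\Pi_\Delta(r)$ together with the persistence rules. Then: 1. For every repair $r'$ of $r$ with respect to $IC$, there exists an answer set $S$ of $\Pi(r)$ such that $r' = \{p(\bar a) \mid p \text{ a database predicate},\ p'(\bar a)\in S\}$. 2. For every answer set $S$ of $\Pi(r)$, there exists a repair $r'$ of $r$ with respect to $IC$ such that $r' = \{p(\bar a)\mid p \text{ a database predicate},\ p'(\bar a)\in S\}$.
   Context: **Databases.** $D$ is a finite set of constants. A schema is a finite set of database predicates $p$ (with arities). There may also be built-in predicates (equality, order, etc.), which have a fixed interpretation over $D$. A database instance is a finite set of ground atoms $p(\bar a)$, $p$ a database predicate, $\bar a$ a tuple over $D$ (built-in atoms are not members of instances). Instances are viewed as first-order structures with domain $D$: $r\models p(\bar a)$ iff $p(\bar a)\in r$. **Binary integrity constraints (BICs).** A BIC is a universally quantified formula $\bigvee_{i=1}^n p_i(\bar x_i)\vee\bigvee_{i=1}^m\neg q_i(\bar y_i)\vee\varphi$ with $1\le n+m\le 2$, where $p_i,q_i$ are database predicates, $\bar x_i,\bar y_i$ are tuples of variables, and $\varphi$ is a formula containing only built-in predicates, whose variables are among those of the $\bar x_i,\bar y_i$. A set $IC$ of BICs is always assumed consistent: some database instance over $D$ satisfies it. **Repairs.** A repair of $r$ w.r.t. $IC$ is a database instance $r'$ over the same schema and domain with $r'\models IC$ such that the symmetric difference $\Delta(r,r')$ is minimal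 under set inclusion in $\{\Delta(r,r^* )\mid r^*\models IC\}$. **Programs.** Literals are atoms $A$ or their classical negations $\neg A$; $not$ is weak negation. For each database predicate $p$ there is a new predicate $p'$ of the same arity, and there is a unary predicate $dom$. $dom(\bar X_1,\dots,\bar X_k)$ abbreviates the conjunction of $dom(X)$ over all components $X$ of the tuples. All rules are identified with their ground instances over $D$. A condition $not\ \varphi$ with $\varphi$ built-in is evaluated in the fixed interpretation (it holds iff $\varphi$ is false). The change program $\Pi_\Delta(r)$ consists of: 1. Facts: $p(\bar a)$ for every $p(\bar a)\in r$; $dom(a)$ for every $a\in D$. 2. For each BIC $\bigvee_{i=1}^n p_i(\bar x_i)\vee\bigvee_{i=1}^m\neg q_i(\bar y_i)\vee\varphi$ in $IC$, the triggering rule $\bigvee_{i=1}^n p_i'(\bar X_i)\vee\bigvee_{i=1}^m\neg q_i'(\bar Y_i)\leftarrow dom(\bar X_1,\dots,\bar X_n),\ not\ p_1(\bar X_1),\dots,not\ p_n(\bar X_n),\ q_1(\bar Y_1),\dots,q_m(\bar Y_m),\ not\ \varphi.$ 3. Stabilizing rules. For each BIC with $n+m=2$, and each of its two database literals: the rule whose head is the primed version of the other literal and whose body is $dom(\bar X_1,\dots,\bar X_n,\bar Y_1,\dots,\bar Y_m)$, the complement of the primed version of the chosen literal, and $not\ \varphi$ (so choosing $p_j(\bar x_j)$ puts $\neg p_j'(\bar X_j)$ in the body, and choosing $\neg q_j(\bar y_j)$ puts $q_j'(\bar Y_j)$ in the body). For each BIC with $n+m=1$: the rule $p_1'(\bar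 X_1)\leftarrow dom(\bar X_1),\ not\ \varphi$ if $n=1$, respectively $\neg q_1'(\bar Y_1)\leftarrow dom(\bar Y_1),\ not\ \varphi$ if $m=1$. The repair program $\Pi(r)$ is $\Pi_\Delta(r)$ plus, for every database predicate $p$, the persistence rules $p'(\bar X)\leftarrow p(\bar X),\ not\ \neg p'(\bar X)$ and $\neg p'(\bar X)\leftarrow dom(\bar X),\ not\ p(\bar X),\ not\ p'(\bar X).$ **Answer sets.** For a ground program $\Pi$ and a set $S$ of ground literals without complementary pairs, the reduct ${}^S\Pi$ is obtained by deleting every rule having some $not\ L$ in its body with $L\in S$, and deleting all conditions $not\ L$ from the remaining rules. $S$ is an answer set of $\Pi$ if $S$ is a minimal (under inclusion) set of ground literals without complementary pairs that satisfies all rules of ${}^S\Pi$ (if all body literals are in the set, then some head literal is in the set). *)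

(* Defs.v *)
From HB Require Import structures.
From mathcomp Require Import all_boot.

Set Implicit Arguments.
Unset Strict Implicit.
Unset Printing Implicit Defensive.

Section Atoms.
Variables (P : finType) (ar : P -> nat).

(* p(t_1, ..., t_k) with k = ar p: ground when T is the domain D, open when T
   is a type 'I_k of variables. *)
Definition atom (T : Type) : Type := {p : P & (ar p).-tuple T}.

HB.instance Definition _ (T : finType) := Finite.on (atom T).

Definition inst (T U : Type) (v : T -> U) (a : atom T) : atom U :=
  existT _ (tag a) (map_tuple v (tagged a)).

Definition args (T : Type) (a : atom T) : seq T := tval (tagged a).

Definition instance (D : finType) : Type := {set atom D}.

Definition symdiff (D : finType) (r1 r2 : instance D) : {set atom D} :=
  (r1 :\: r2) :|: (r2 :\: r1).

End Atoms.

Section BuiltinFormulas.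
Variables (D : finType) (B : Type) (arB : B -> nat).

Inductive term (k : nat) : Type :=
| Var of 'I_k
| Cst of D.

(* [bform k]: first-order formulas over the built-in predicates, with free
   variables in 'I_k; under a quantifier ord0 is the bound variable and the
   outer variables are shifted by one. *)
Inductive bform : nat -> Type :=
| BFalse k : bform k
| BAtom k (b : B) of (arB b).-tuple (term k) : bform k
| BNot k of bform k : bform k
| BAnd k of bform k & bform k : bform k
| BOr k of bform k & bform k : bform k
| BAll k of bform k.+1 : bform k
| BEx k of bform k.+1 : bform k.

Variable I : forall b : B, (arB b).-tuple D -> bool.

Definition teval k (v : 'I_k -> D) (t : term k) : D :=
  match t with Var i => v i | Cst d => d end.

Definition scons k (d : D) (v : 'I_k -> D) (i : 'I_k.+1) : D :=
  oapp v d (unlift ord0 i).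

Fixpoint beval k (f : bform k) : ('I_k -> D) -> bool :=
  match f in bform k return ('I_k -> D) -> bool with
  | BFalse _ => fun _ => false
  | BAtom _ b ts => fun v => I (map_tuple (teval v) ts)
  | BNot _ f => fun v => ~~ beval f v
  | BAnd _ f g => fun v => beval f v && beval g v
  | BOr _ f g => fun v => beval f v || beval g v
  | BAll _ f => fun v => [forall d, beval f (scons d v)]
  | BEx _ f => fun v => [exists d, beval f (scons d v)]
  end.

End BuiltinFormulas.

(* Literals with classical negation over an arbitrary type of atoms. *)
Inductive lit (A : Type) : Type :=
| Pos of A
| Neg of A.

Definition compl (A : Type) (l : lit A) : lit A :=
  match l with Pos a => Neg a | Neg a => Pos a end.

Definition lit_map (A A' : Type) (f : A -> A') (l : lit A) : lit A' :=
  match l with Pos a => Pos (f a) | Neg a => Neg (f a) end.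

Section LitFinite.
Variable A : Type.
Definition lit_code (l : lit A) : A + A :=
  match l with Pos a => inl a | Neg a => inr a end.
Definition lit_decode (x : A + A) : lit A :=
  match x with inl a => Pos a | inr a => Neg a end.
Lemma lit_codeK : cancel lit_code lit_decode. Proof. by case. Qed.
End LitFinite.

HB.instance Definition _ (A : finType) :=
  Finite.copy (lit A) (can_type (@lit_codeK A)).

Section AnswerSets.
Variable A : finType.

(* A ground disjunctive rule
     head <- pbody, not L (for L in nbody). *)
Record grule : Type := GRule {
  head : seq (lit A);
  pbody : seq (lit A);
  nbody : seq (lit A)
}.

Definition program : Type := grule -> Prop.

Definition lits_consistent (S : {set lit A}) : Prop :=
  forall a : A, ~ (Pos a \in S /\ Neg a \in S).

Definition reduct (S : {set lit A}) (Pi : program) : program :=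
  fun rho => exists rho0, [/\ Pi rho0, {in nbody rho0, forall l, l \notin S}
    & rho = GRule (head rho0) (pbody rho0) [::]].

(* Ignores nbody: meant for programs without weak negation, such as reducts. *)
Definition satisfies_rules (T : {set lit A}) (Pi : program) : Prop :=
  forall rho, Pi rho -> {in pbody rho, forall l, l \in T} ->
    exists2 l, l \in head rho & l \in T.

Definition answer_set (Pi : program) (S : {set lit A}) : Prop :=
  [/\ lits_consistent S, satisfies_rules S (reduct S Pi)
    & forall T : {set lit A}, lits_consistent T ->
        satisfies_rules T (reduct S Pi) -> T \subset S -> T = S].

End AnswerSets.

Section RepairPrograms.
Variables (D P : finType) (ar : P -> nat).
Variables (B : Type) (arB : B -> nat).

(* The universal closure of
     \/_(a in bic_pos) a  \/  \/_(a in bic_neg) ~ a  \/  bic_phi,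
   whose variables are indexed by 'I_bic_nvar. *)
Record bic : Type := Bic {
  bic_nvar : nat;
  bic_pos : seq (atom ar 'I_bic_nvar);
  bic_neg : seq (atom ar 'I_bic_nvar);
  bic_phi : bform D arB bic_nvar;
  bic_binary : 1 <= size bic_pos + size bic_neg <= 2;
  bic_range : forall i : 'I_bic_nvar,
    has (fun a => i \in args a) (bic_pos ++ bic_neg)
}.

Variable I : forall b : B, (arB b).-tuple D -> bool.

Definition gpos (c : bic) (v : 'I_(bic_nvar c) -> D) : seq (atom ar D) :=
  map (inst v) (bic_pos c).
Definition gneg (c : bic) (v : 'I_(bic_nvar c) -> D) : seq (atom ar D) :=
  map (inst v) (bic_neg c).

Definition bic_sat (r : instance ar D) (c : bic) : Prop :=
  forall v : 'I_(bic_nvar c) -> D,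
    [|| has (fun a => a \in r) (gpos v), has (fun a => a \notin r) (gneg v)
      | beval I (bic_phi c) v].

Definition sat (r : instance ar D) (IC : bic -> Prop) : Prop :=
  forall c, IC c -> bic_sat r c.

Definition ic_consistent (IC : bic -> Prop) : Prop :=
  exists r : instance ar D, sat r IC.

Definition repair (IC : bic -> Prop) (r r' : instance ar D) : Prop :=
  sat r' IC /\
  forall r1 : instance ar D, sat r1 IC ->
    symdiff r r1 \subset symdiff r r' -> symdiff r r1 = symdiff r r'.

(* Ground atoms of the program: [Db a] is p(abar), [Prm a] is p'(abar) and
   [Dom d] is dom(d). *)
Inductive patom : Type :=
| Db of atom ar D
| Prm of atom ar D
| Dom of D.

Definition patom_code (x : patom) : atom ar D + atom ar D + D :=
  match x with Db a => inl (inl a) | Prm a => inl (inr a) | Dom d => inr d end.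
Definition patom_decode (x : atom ar D + atom ar D + D) : patom :=
  match x with inl (inl a) => Db a | inl (inr a) => Prm a | inr d => Dom d end.
Lemma patom_codeK : cancel patom_code patom_decode. Proof. by case. Qed.

HB.instance Definition _ := Finite.copy patom (can_type patom_codeK).

Definition dom_lits (s : seq (atom ar D)) : seq (lit patom) :=
  [seq Pos (Dom d) | d <- flatten (map (@args P ar D) s)].

Definition prime (l : lit (atom ar D)) : lit patom := lit_map Prm l.

Definition glits (c : bic) (v : 'I_(bic_nvar c) -> D) :
    seq (lit (atom ar D)) :=
  map (@Pos _) (gpos v) ++ map (@Neg _) (gneg v).

Definition gdom (c : bic) (v : 'I_(bic_nvar c) -> D) : seq (lit patom) :=
  dom_lits (gpos v ++ gneg v).

(* All rules are given by their ground instances; a body condition "not phi"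
   with phi built-in becomes a side condition on the instance. *)
Inductive change_program (IC : bic -> Prop) (r : instance ar D) :
    program patom :=
| fact_db a of a \in r :
    change_program IC r (GRule [:: Pos (Db a)] [::] [::])
| fact_dom d :
    change_program IC r (GRule [:: Pos (Dom d)] [::] [::])
| triggering c v of IC c & ~~ beval I (bic_phi c) v :
    change_program IC r
      (GRule (map prime (glits v))
             (dom_lits (gpos v) ++ [seq Pos (Db a) | a <- gneg v])
             [seq Pos (Db a) | a <- gpos v])
| stabilizing_fst c v l1 l2 of
    IC c & ~~ beval I (bic_phi c) v & glits v = [:: l1; l2] :
    change_program IC r
      (GRule [:: prime l2] (rcons (gdom v) (compl (prime l1))) [::])
| stabilizing_snd c v l1 l2 of
    IC c & ~~ beval I (bic_phi c) v & glits v = [:: l1; l2] :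
    change_program IC r
      (GRule [:: prime l1] (rcons (gdom v) (compl (prime l2))) [::])
| stabilizing_unary c v l of
    IC c & ~~ beval I (bic_phi c) v & glits v = [:: l] :
    change_program IC r (GRule [:: prime l] (gdom v) [::]).

Inductive repair_program (IC : bic -> Prop) (r : instance ar D) :
    program patom :=
| change rho of change_program IC r rho : repair_program IC r rho
| persistence_pos a :
    repair_program IC r
      (GRule [:: Pos (Prm a)] [:: Pos (Db a)] [:: Neg (Prm a)])
| persistence_neg a :
    repair_program IC r
      (GRule [:: Neg (Prm a)] (dom_lits [:: a])
             [:: Pos (Db a); Pos (Prm a)]).

Definition primed_instance (S : {set lit patom}) : instance ar D :=
  [set a | Pos (Prm a) \in S].

End RepairPrograms.

(* Main.v *)
(* An answer set S of the repair program decides every primed atom, so it is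
   determined by the instance r' it encodes, and its reduct keeps as facts
   exactly the primed literals on which r and r' agree.  Hence minimality of S
   corresponds to minimality of symdiff r r':
   - a model T of the reduct included in S yields the instance obtained from r
     by performing only the changes recorded in T; triggering rules repair the
     clauses violated by r and stabilizing rules preserve the other ones;
   - an instance r1 satisfying IC with symdiff r r1 included in symdiff r r'
     yields the set of literals common to the encodings of r' and r1.  It is a
     model of the reduct: when a literal of a binary clause is false in both r'
     and r1, the other literal is true in both. *)
From mathcomp Require Import all_boot.
Require Import Defs.

Set Implicit Arguments.
Unset Strict Implicit.
Unset Printing Implicit Defensive.

Section RepairAnswerSets.
Variables (D P : finType) (ar : P -> nat).
Variables (B : Type) (arB : B -> nat).
Variable I : forall b : B, (arB b).-tuple D -> bool.
Variables (IC : bic D ar arB -> Prop) (r : instance ar D).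

Implicit Types r : instance ar D.
Implicit Types S T : {set lit (patom D ar)}.

(** * Ground clauses of the constraints *)

Definition holds r' (l : lit (atom ar D)) : bool :=
  match l with Pos a => a \in r' | Neg a => a \notin r' end.

Lemma holds_compl r' l : holds r' (compl l) = ~~ holds r' l.
Proof. by case: l => a //=; rewrite negbK. Qed.

Lemma prime_compl (l : lit (atom ar D)) : prime (compl l) = compl (prime l).
Proof. by case: l. Qed.

(** Keeping only the valuations with false built-in part selects exactly the instances that give
    rise to triggering and stabilizing rules; the others are true in every database. *)
Definition ground_clause (ls : seq (lit (atom ar D))) : Prop :=
  exists c v, [/\ IC c, ~~ beval I (bic_phi c) v & ls = @glits D P ar B arB c v].

Lemma has_glits r' (c : bic D ar arB) (v : 'I_(bic_nvar c) -> D) :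
  has (holds r') (glits v) =
  has (fun a => a \in r') (gpos v) || has (fun a => a \notin r') (gneg v).
Proof. by rewrite has_cat !has_map. Qed.

Lemma sat_clauses r' :
  sat I r' IC <-> forall ls, ground_clause ls -> has (holds r') ls.
Proof.
split=> [sat_r' ls [c [v [ICc phiF ->]]] | clr' c ICc v].
  by have:= sat_r' c ICc v; rewrite has_glits orbA (negPf phiF) orbF.
case: (boolP (beval I (bic_phi c) v)) => [_ | phiF]; first by rewrite !orbT.
by rewrite orbF -has_glits; apply: clr'; exists c, v.
Qed.

Lemma ground_clause_binary ls : ground_clause ls ->
  (exists l, ls = [:: l]) \/ (exists l1 l2, ls = [:: l1; l2]).
Proof.
move=> [c [v [_ _ ->]]].
have: 1 <= size (glits v) <= 2.
  by rewrite size_cat !size_map; exact: bic_binary.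
case: (glits v) => [|l1 [|l2 []]] // _; [by left; exists l1|].
by right; exists l1, l2.
Qed.

(** * Encodings of instances and models of their reducts *)

(** The intended answer set for [r']: the facts, plus exactly one primed literal per ground database
    atom. *)
Definition encoding r' : {set lit (patom D ar)} :=
  [set l | match l with
    | Pos (Db a) => a \in r
    | Pos (Dom _) => true
    | Pos (Prm a) => a \in r'
    | Neg (Prm a) => a \notin r'
    | Neg _ => false
    end].

Lemma encoding_prime r' l : (prime l \in encoding r') = holds r' l.
Proof. by rewrite inE; case: l. Qed.

Lemma encoding_consistent r' : lits_consistent (encoding r').
Proof. by case=> [a|a|d]; rewrite !inE => -[] // ->. Qed.

Lemma primed_encoding r' : primed_instance (encoding r') = r'.
Proof. by apply/setP=> a; rewrite !inE. Qed.

Lemma subset_consistent S T :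
  T \subset S -> lits_consistent S -> lits_consistent T.
Proof.
by move=> /subsetP sTS consS a [Ta Na]; apply: (consS a); split; apply: sTS.
Qed.

Lemma dom_lits_sub T (s : seq (atom ar D)) :
  (forall d, Pos (Dom ar d) \in T) -> {in dom_lits s, forall l, l \in T}.
Proof. by move=> TD _ /mapP[d _ ->]. Qed.

(** The reduct restated in terms of clauses. [model_persist] merges both persistence rules: a rule
    that survives reduction and whose body holds produces a literal true in both [r] and [r']. *)
Record reduct_model r' T : Prop := ReductModel {
  model_db : forall a, a \in r -> Pos (Db a) \in T;
  model_dom : forall d, Pos (Dom ar d) \in T;
  model_trigger : forall ls, ground_clause ls -> ~~ has (holds r) ls ->
    exists2 l, l \in ls & prime l \in T;
  model_stab1 : forall l1 l2, ground_clause [:: l1; l2] ->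
    prime (compl l1) \in T -> prime l2 \in T;
  model_stab2 : forall l1 l2, ground_clause [:: l1; l2] ->
    prime (compl l2) \in T -> prime l1 \in T;
  model_unary : forall l, ground_clause [:: l] -> prime l \in T;
  model_persist : forall l, holds r l -> holds r' l -> prime l \in T
}.

(** Inclusion in [encoding r'] bounds the [Db] atoms of [T] by [r], so a triggering body true in [T]
    comes from a clause false in [r]. *)
Lemma satisfies_reduct r' T : T \subset encoding r' ->
  satisfies_rules T (reduct (encoding r') (repair_program I IC r)) <->
  reduct_model r' T.
Proof.
move=> /subsetP sT.
have TDb a : Pos (Db a) \in T -> a \in r by move/sT; rewrite inE.
split=> [modT | [mdb mdom mtrig mst1 mst2 mun mper]].
  have fire hd pb nb : repair_program I IC r (GRule hd pb nb) ->
      {in nb, forall l, l \notin encoding r'} -> {in pb, forall l, l \in T} ->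
      exists2 l, l \in hd & l \in T.
    by move=> Pi Hn Hp; apply: (modT (GRule hd pb [::])) => //; eexists; split;
      [exact: Pi | |].
  have fire1 l pb nb : repair_program I IC r (GRule [:: l] pb nb) ->
      {in nb, forall l, l \notin encoding r'} -> {in pb, forall l, l \in T} ->
      l \in T.
    by move=> Pi Hn Hp; have [_ /[1!inE]/eqP->] := fire _ _ _ Pi Hn Hp.
  have TD d : Pos (Dom ar d) \in T.
    by apply: fire1 => //; [apply/change/fact_dom | |].
  have Tdb a : a \in r -> Pos (Db a) \in T.
    by move=> ra; apply: fire1 => //; [apply/change/fact_db | |].
  have body (c : bic D ar arB) (v : 'I_(bic_nvar c) -> D) l :
      prime (compl l) \in T ->
      {in rcons (gdom v) (compl (prime l)), forall l', l' \in T}.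
    move=> Tl l'; rewrite mem_rcons inE -prime_compl => /orP[/eqP-> // | ].
    exact: dom_lits_sub.
  split=> //.
  - move=> _ [c [v [ICc phiF ->]]]; rewrite has_glits negb_or.
    move=> /andP[/hasPn rpos /hasPn rneg].
    have [||l' /mapP[l lv ->] Tl] :=
      fire _ _ _ (change (triggering r ICc phiF)).
    + by move=> _ /mapP[a /rpos ra ->]; rewrite inE.
    + move=> l'; rewrite mem_cat => /orP[|/mapP[a /rneg/negPn ra ->]].
        exact: dom_lits_sub.
      exact: Tdb.
    + by exists l.
  - move=> l1 l2 [c [v [ICc phiF /esym def_v]]] Tl.
    by apply: (fire1 _ _ [::] _ _ (body c v _ Tl)) => //; apply/change/stabilizing_fst.
  - move=> l1 l2 [c [v [ICc phiF /esym def_v]]] Tl.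
    by apply: (fire1 _ _ [::] _ _ (body c v _ Tl)) => //; apply/change/stabilizing_snd.
  - move=> l [c [v [ICc phiF /esym def_v]]].
    apply: (fire1 _ (gdom v) [::]) => //; last exact: dom_lits_sub.
    by apply/change/stabilizing_unary.
  - case=> a /= ra r'a.
      apply: (fire1 _ _ _ (persistence_pos I IC r a)) => l /[1!inE] /eqP->.
        by rewrite inE r'a.
      exact: Tdb.
    apply: (fire1 _ _ _ (persistence_neg I IC r a)) => [l|].
      by rewrite !inE => /orP[]/eqP->.
    exact: dom_lits_sub.
have body pb l : {in rcons pb (compl (prime l)), forall l', l' \in T} ->
    prime (compl l) \in T.
  by rewrite prime_compl; apply; rewrite mem_rcons mem_head.
move=> _ [rho0 [Pi Hn ->]] /= Hp.
case: rho0 / Pi Hn Hp => [rho [] /=|a|a] /=.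
- by move=> a ra _ _; exists (Pos (Db a)); rewrite ?mem_head ?mdb.
- by move=> d _ _; exists (Pos (Dom ar d)); rewrite ?mem_head.
- move=> c v ICc phiF Hn Hp.
  have [||l lv Tl] := mtrig (glits v); [by exists c, v | |].
    rewrite has_glits negb_or; apply/andP; split; apply/hasPn=> a av.
      by have := Hn _ (map_f (fun a => Pos (Db a)) av); rewrite inE.
    by rewrite negbK TDb // Hp // mem_cat orbC map_f.
  by exists (prime l); rewrite ?map_f.
- move=> c v l1 l2 ICc phiF def_v _ /body Tl.
  exists (prime l2); first exact: mem_head.
  by apply: mst1 Tl; exists c, v.
- move=> c v l1 l2 ICc phiF def_v _ /body Tl.
  exists (prime l1); first exact: mem_head.
  by apply: mst2 Tl; exists c, v.
- move=> c v l ICc phiF def_v _ _.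
  exists (prime l); first exact: mem_head.
  by apply: mun; exists c, v.
- move=> Hn Hp; exists (Pos (Prm a)); first exact: mem_head.
  apply: (mper (Pos a)) => /=; first by rewrite TDb ?Hp ?mem_head.
  by have := Hn _ (mem_head _ _); rewrite inE negbK.
- move=> Hn _; exists (Neg (Prm a)); first exact: mem_head.
  by apply: (mper (Neg a)) => /=; [have := Hn (Pos (Db a)) | have := Hn (Pos (Prm a))];
    rewrite !inE eqxx ?orbT => ->.
Qed.

(** * From repairs to answer sets *)

Lemma repair_answer_set r' :
  repair I IC r r' -> answer_set (repair_program I IC r) (encoding r').
Proof.
move=> [/sat_clauses sat_r' min_r']; split; first exact: encoding_consistent.
  apply/satisfies_reduct => //; split; try by move=> *; rewrite inE.
  - by move=> ls /sat_r' /hasP[l lls r'l] _; exists l; rewrite ?encoding_prime.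
  - by move=> l1 l2 /sat_r'; rewrite !encoding_prime holds_compl /= orbF;
      case: holds.
  - by move=> l1 l2 /sat_r'; rewrite !encoding_prime holds_compl /= orbF orbC;
      case: holds.
  - by move=> l /sat_r'; rewrite encoding_prime /= orbF.
  - by move=> l _; rewrite encoding_prime.
move=> T consT /[swap] sTr' /(satisfies_reduct sTr') mT.
have sT l : prime l \in T -> holds r' l.
  by rewrite -encoding_prime; apply: (subsetP sTr').
(* [T] may leave a primed atom undecided; [r1] then keeps its status from [r]. *)
pose r1 : instance ar D :=
  [set a | (Pos (Prm a) \in T) || (a \in r) && (Neg (Prm a) \notin T)].
have T_r1 l : prime l \in T -> holds r1 l.
  case: l => a /= Ta; rewrite inE Ta //= andbF orbF.
  by apply/negP=> Pa; apply: (consT (Prm a)).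
have changed l : holds r1 l -> ~~ holds r l -> prime l \in T.
  case: l => a /=; rewrite inE; first by case: (a \in r); rewrite ?orbF.
  by rewrite negbK => /[swap] ->; rewrite negb_or negbK => /andP[].
have sat_r1 : sat I r1 IC.
  apply/sat_clauses=> ls cls; case: (boolP (has (holds r) ls)); last first.
    move=> /(model_trigger mT cls)[l lls Tl].
    by apply/hasP; exists l; rewrite ?T_r1.
  have [[l def_ls]|[l1 [l2 def_ls]]] := ground_clause_binary cls; subst ls.
    by move=> _; rewrite /= T_r1 // (model_unary mT).
  rewrite /= !orbF.
  (* If a literal true in [r] becomes false in [r1], its complement is a change recorded in [T], and
     the matching stabilizing rule puts the other literal into [T], hence makes it true in [r1]. *)
  case: (boolP (holds r1 l1)) => //= r1l1; case/orP=> rl.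
    apply/T_r1/(model_stab1 mT cls)/changed; first by rewrite holds_compl.
    by rewrite holds_compl negbK.
  case: (boolP (holds r1 l2)) => //= r1l2.
  have /T_r1 : prime l1 \in T.
    apply/(model_stab2 mT cls)/changed; first by rewrite holds_compl.
    by rewrite holds_compl negbK.
  by rewrite (negPf r1l1).
have r1_diff : symdiff r r1 \subset symdiff r r'.
  apply/subsetP=> a; rewrite !in_setU !in_setD => /orP[]/andP[].
    move=> r1a ra; have /= -> : holds r' (Neg a); last by rewrite ra.
    by apply/sT/changed; rewrite //= negbK.
  move=> ra r1a; have /= -> : holds r' (Pos a); last by rewrite ra orbT.
  exact/sT/changed.
have /setP eq_diff := min_r' r1 sat_r1 r1_diff.
have def_r1 : r1 = r'.
  apply/setP=> a; have := eq_diff a; rewrite !in_setU !in_setD.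
  by case: (a \in r); case: (a \in r1); case: (a \in r').
apply/eqP; rewrite eqEsubset sTr'; apply/subsetP=> l.
(* Persistence supplies the literals on which [r] and [r'] agree; the remaining ones are changes
   made by [r1], now equal to [r'], and so belong to [T]. *)
have Tprime l0 : holds r' l0 -> prime l0 \in T.
  move=> r'l0; have [rl0|rl0] := boolP (holds r l0).
    exact: (model_persist mT).
  by apply: changed; rewrite ?def_r1.
rewrite inE; case: l => -[a|a|d] //.
- exact: model_db mT a.
- by move=> r'a; apply: (Tprime (Pos a)).
- by move=> _; apply: (model_dom mT).
- by move=> r'a; apply: (Tprime (Neg a)).
Qed.

(** * From answer sets to repairs *)

(* By minimality, [S] contains no unprimed literal beyond the facts. *)
Lemma answer_set_unprimed S : answer_set (repair_program I IC r) S ->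
  S \subset [set l | match l with
    | Pos (Db a) => a \in r
    | Neg (Db _) | Neg (Dom _) => false
    | _ => true
    end].
Proof.
move=> [consS modS minS]; set U := [set _ | _].
(* Every rule head lies in [U], so the head literal provided by [S] survives the intersection, which
   is therefore a model of the reduct. *)
suff <- : S :&: U = S by exact: subsetIr.
apply: minS (subsetIl _ _); first exact: subset_consistent (subsetIl _ _) consS.
have primeU l : prime l \in U by rewrite inE; case: l.
move=> rho red_rho Hp.
have [l lrho Sl] : exists2 l, l \in head rho & l \in S.
  by apply: (modS _ red_rho) => l /Hp /setIP[].
exists l => //; rewrite inE Sl /=.
case: red_rho lrho => rho0 [Pi _ ->] /= {Hp}.
case: rho0 / Pi => [_ []|a|a] /=.
- by move=> a ra /[1!inE]/eqP->; rewrite inE.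
- by move=> d /[1!inE]/eqP->; rewrite inE.
- by move=> c v _ _ /mapP[l0 _ ->]; exact: primeU.
- by move=> c v l1 l2 _ _ _ /[1!inE]/eqP->; exact: primeU.
- by move=> c v l1 l2 _ _ _ /[1!inE]/eqP->; exact: primeU.
- by move=> c v l1 _ _ _ /[1!inE]/eqP->; exact: primeU.
- by move=> /[1!inE]/eqP->; rewrite inE.
- by move=> /[1!inE]/eqP->; rewrite inE.
Qed.

(** Facts fix the unprimed part. For a primed atom, consistency excludes having both signs, and a
    persistence rule fires when neither is present. *)
Lemma answer_set_encoding S : answer_set (repair_program I IC r) S ->
  S = encoding (primed_instance S).
Proof.
move=> ansS; have /subsetP sSU := answer_set_unprimed ansS.
have [consS modS _] := ansS.
have fire l pb nb : repair_program I IC r (GRule [:: l] pb nb) ->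
    {in nb, forall l, l \notin S} -> {in pb, forall l, l \in S} -> l \in S.
  move=> Pi Hn Hp; have [||l'] := modS (GRule [:: l] pb [::]) => //.
    by eexists; split; [exact: Pi | |].
  by rewrite inE => /eqP->.
have SD d : Pos (Dom ar d) \in S.
  by apply: fire => //; [apply/change/fact_dom | |].
have SDb a : (Pos (Db a) \in S) = (a \in r).
  apply/idP/idP=> [/sSU|ra]; first by rewrite inE.
  by apply: fire => //; [apply/change/fact_db | |].
apply/setP=> -[] [a|a|d]; rewrite ?SD ?SDb inE ?inE //;
  try by apply/negP=> /sSU; rewrite inE.
apply/idP/idP=> [Na|Pa]; first by apply/negP=> Pa; apply: (consS (Prm a)).
have [ra|ra] := boolP (a \in r).
  apply: contraNT Pa => Na; apply: (fire _ _ _ (persistence_pos I IC r a)).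
    by move=> l /[1!inE] /eqP->.
  by move=> l /[1!inE] /eqP->; rewrite SDb.
apply: (fire _ _ _ (persistence_neg I IC r a)); last exact: dom_lits_sub.
by move=> l; rewrite !inE => /orP[]/eqP-> //; rewrite SDb.
Qed.

Lemma answer_set_repair S : answer_set (repair_program I IC r) S ->
  repair I IC r (primed_instance S).
Proof.
move=> ansS; have := ansS; rewrite {1}(answer_set_encoding ansS).
move: (primed_instance S) => r' {S ansS} [_ modS minS].
have {modS} mS : reduct_model r' (encoding r') by apply/satisfies_reduct.
have sat_r' ls : ground_clause ls -> has (holds r') ls.
  move=> cls; have [[l def_ls]|[l1 [l2 def_ls]]] := ground_clause_binary cls.
    by subst ls; rewrite /= -encoding_prime (model_unary mS cls).
  (* Since the encoding decides every primed atom, a stabilizing rule is the clause itself read as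
     an implication. *)
  subst ls; have := model_stab1 mS cls.
  by rewrite !encoding_prime holds_compl /= orbF; case: holds => //=; apply.
split; first by apply/sat_clauses.
move=> r1 /sat_clauses sat_r1 /subsetP r1_diff.
(* The inclusion of differences, split in two: [r1] preserves whatever [r'] preserves, and every
   change made by [r1] is also made by [r']. *)
have agree l : holds r l -> holds r' l -> holds r1 l.
  case: l => a /=; have /implyP := r1_diff a; rewrite !in_setU !in_setD;
  by case: (a \in r); case: (a \in r'); case: (a \in r1).
have changed l : holds r1 l -> ~~ holds r l -> holds r' l.
  case: l => a /=; have /implyP := r1_diff a; rewrite !in_setU !in_setD;
  by case: (a \in r); case: (a \in r'); case: (a \in r1).
pose T := encoding r' :&: encoding r1.
have sT : T \subset encoding r' := subsetIl _ _.
have Tprime l : (prime l \in T) = holds r' l && holds r1 l.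
  by rewrite in_setI !encoding_prime.
have defT : T = encoding r'.
  apply: minS (sT); first exact: subset_consistent sT (@encoding_consistent r').
  apply/satisfies_reduct => //; split; try by move=> *; rewrite !inE //; apply/andP.
  (* A clause false in [r] but true in [r1] has a literal changed by [r1], hence also by [r']. *)
  - move=> ls /sat_r1 /hasP[l lls r1l] /hasPn/(_ l lls) rl; exists l => //.
    by rewrite Tprime r1l changed.
  - move=> l1 l2 cls; rewrite !Tprime !holds_compl.
    by have := sat_r' _ cls; have := sat_r1 _ cls; rewrite /= !orbF;
      do 2!case: (holds _ l1) => //=; move=> -> ->.
  - move=> l1 l2 cls; rewrite !Tprime !holds_compl.
    by have := sat_r' _ cls; have := sat_r1 _ cls; rewrite /= !orbF;
      do 2!case: (holds _ l2); rewrite ?orbT ?orbF //= => -> ->.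
  - move=> l cls; rewrite Tprime.
    by have := sat_r' _ cls; have := sat_r1 _ cls; rewrite /= !orbF => -> ->.
  - by move=> l rl r'l; rewrite Tprime r'l agree.
suff -> : r1 = r' by [].
(* Stated for literals of both signs, this one implication yields both inclusions between [r1] and
   [r']. *)
have r'_r1 l : holds r' l -> holds r1 l.
  by rewrite -encoding_prime -defT Tprime => /andP[].
apply/setP=> a; apply/idP/idP; last exact: (r'_r1 (Pos a)).
by apply: contraLR; apply: (r'_r1 (Neg a)).
Qed.

End RepairAnswerSets.

Theorem theorem1 (D P : finType) (ar : P -> nat)
    (B : Type) (arB : B -> nat) (I : forall b : B, (arB b).-tuple D -> bool)
    (IC : bic D ar arB -> Prop) (hIC : ic_consistent I IC)
    (r : instance ar D) :
  (forall r' : instance ar D, repair I IC r r' ->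
     exists S : {set lit (patom D ar)},
       answer_set (repair_program I IC r) S /\ r' = primed_instance S) /\
  (forall S : {set lit (patom D ar)}, answer_set (repair_program I IC r) S ->
     exists r' : instance ar D,
       repair I IC r r' /\ r' = primed_instance S).
Proof.
split=> [r' rep_r' | S ansS].
  by exists (encoding r r'); rewrite primed_encoding; split=> //;
    exact: repair_answer_set.
by exists (primed_instance S); split=> //; apply: answer_set_repair.
Qed.
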